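(* Let $G$ be a non-periodic group and let $A$ be an infinite set. Then there exists a bijective cellular automaton $\tau \colon A^G \to A^G$ which is not reversible.
   Context: A group is periodic if all its elements have finite order; it is non-periodic otherwise. For a group $G$ and a set $A$, $A^G$ denotes the set of all maps $x \colon G \to A$, with left $G$-action (the shift) given by $(gx)(h) = x(g^{-1}h)$ for $g,h \in G$, $x \in A^G$. A cellular automaton over the group $G$ and the alphabet $A$ is a map $\tau \colon A^G \to A^G$ for which there exist a finite subset $M \subset G$ and a map $\mu \colon A^M \to A$ such that $\tau(x)(g) = \mu(\pi_M(g^{-1}x))$ for all $x \in A^G$ and $g \in G$, where $\pi_M \colon A^G \to A^M$ is the restriction map. A cellular automaton $\tau \colon A^G \to A^G$ is reversible if $\tau$ is bijective and the inverse map $\tau^{-1} \colon A^G \to A^G$ is also a cellular automaton. *)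

(* Defs.v *)
From mathcomp Require Import all_boot.
From mathcomp Require Import monoid.
From mathcomp Require Import boolp classical_sets functions cardinality.

Set Implicit Arguments.
Unset Strict Implicit.
Unset Printing Implicit Defensive.

Local Open Scope classical_set_scope.
Local Open Scope group_scope.

Definition periodic (G : groupType) : Prop :=
  forall g : G, exists2 n : nat, (0 < n)%N & g ^+ n = 1.

Definition shift (G : groupType) (A : Type) (g : G) (x : G -> A) : G -> A :=
  fun h => x (g^-1 * h).

(* The subset M coerces to the type of its elements, so that M -> A is A^M,
   and sigL M is the restriction map from A^G to A^M. *)
Definition cellular_automaton (G : groupType) (A : Type)
    (tau : (G -> A) -> (G -> A)) : Prop :=
  exists M : set G, finite_set M /\
  exists mu : (M -> A) -> A,
    forall (x : G -> A) (g : G), tau x g = mu (sigL M (shift g^-1 x)).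

(* A two-sided inverse of tau is unique, so sigma is the inverse map of tau;
   its existence includes the bijectivity of tau. *)
Definition reversible (G : groupType) (A : Type)
    (tau : (G -> A) -> (G -> A)) : Prop :=
  exists sigma : (G -> A) -> (G -> A),
    [/\ cancel tau sigma, cancel sigma tau & cellular_automaton sigma].

(* Main.v *)
Require Import Defs.
From mathcomp Require Import all_boot.
From mathcomp Require Import monoid.
From mathcomp Require Import boolp classical_sets functions cardinality.

(** Every symbol of the alphabet is given a level (a natural number) and a bit,
    in such a way that on levels above 0 the bit can be flipped. Let t have
    infinite order. The automaton flips the symbol at g exactly when the symbol
    at g * t lies one level below it and has bit 1. Levels never change, so
    along the sequence g, g * t, g * t ^+ 2, ... the influence of a symbol only
    travels through strictly decreasing levels. Hence the original
    configuration is recovered by recursion on the level: a symbol of level 0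
    was left alone, and a symbol of level l + 1 is repaired once its neighbour
    of level l is known ([automaton_bij]).

    This recursion has to read up to l cells further when the level is l. As
    the alphabet is infinite, l is unbounded, so that no finite memory set M
    suffices for the inverse: if t ^+ n is not in M, consider the two
    configurations with levels n, n - 1, ..., 0 along 1, t, ..., t ^+ n and all
    bits equal to 0, respectively to 1. Their images only differ at t ^+ n,
    while they themselves differ at 1 ([automaton_irreversible]). *)

Set Implicit Arguments.
Unset Strict Implicit.
Unset Printing Implicit Defensive.

Local Open Scope group_scope.

(** * Alphabets with levels and bits *)

(** [symK] is restricted to positive levels because an alphabet need not be in
    bijection with nat * bool: the surplus symbols all go to level 0. *)
Record leveled (A : Type) := Leveled {
  lev : A -> nat;
  bit : A -> bool;
  sym : nat -> bool -> A;
  lev_sym : forall l b, lev (sym l b) = l;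
  bit_sym : forall l b, bit (sym l b) = b;
  symK : forall a, (0 < lev a)%N -> sym (lev a) (bit a) = a }.

Lemma infinite_setT_inj (A : Type) :
  infinite_set [set: A]%classic -> exists c : nat -> A, injective c.
Proof.
move/infiniteP/card_leP=> [f].
exists (fun n => set_val (f (to_setT n))) => m n /val_inj ff.
have /(_ (to_setT m) (to_setT n)) := @inj _ _ _ f.
by rewrite !inE => /(_ I I ff) /(congr1 set_val).
Qed.

(** Level l with bit b is encoded by the number 2 * l + b. *)
Lemma infinite_leveled (A : Type) :
  infinite_set [set: A]%classic -> exists _ : leveled A, True.
Proof.
move=> /infinite_setT_inj [c c_inj].
(* The default code 0 puts the symbols outside of the range of c at level 0. *)
have [d dP] : exists d : A -> nat, forall a,
    c (d a) = a \/ (d a = 0%N /\ forall n, c n <> a).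
  suff /choice[d dP] a : exists n, c n = a \/ (n = 0%N /\ forall n, c n <> a).
    by exists d.
  have [[n cn]|nc] := pselect (exists n, c n = a).
    by exists n; left.
  by exists 0%N; right; split=> // n cn; apply: nc; exists n.
have cK n : d (c n) = n.
  by case: (dP (c n)) => [/c_inj|[_ /(_ n)]].
unshelve eexists; last by [].
apply: (@Leveled A (fun a => (d a)./2) (fun a => odd (d a))
          (fun l b => c (b + l.*2)%N)) => [l b|l b|a a_gt0].
- by rewrite cK half_bit_double.
- by rewrite cK oddD odd_double addbF oddb.
- rewrite odd_double_half; case: (dP a) => // -[da _].
  by rewrite da in a_gt0.
Qed.

Section Automaton.

Variables (G : groupType) (A : Type) (S : leveled A) (t : G).

(** * A bijective automaton *)

Definition step (a : A) (l : nat) (b : bool) : A :=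
  if (lev S a == l.+1) && b then sym S (lev S a) (~~ bit S a) else a.

Definition automaton (x : G -> A) (g : G) : A :=
  step (x g) (lev S (x (g * t))) (bit S (x (g * t))).

Lemma lev_step a l b : lev S (step a l b) = lev S a.
Proof. by rewrite /step; case: ifP => // _; rewrite lev_sym. Qed.

Lemma stepK a l b : step (step a l b) l b = a.
Proof.
rewrite /step; case c: ((lev S a == l.+1) && b) => /=; last by rewrite c.
by rewrite lev_sym c bit_sym negbK symK //; case/andP: c => /eqP ->.
Qed.

Lemma step_lev0 a l b : lev S a = 0%N -> step a l b = a.
Proof. by rewrite /step => ->. Qed.

Lemma lev_automaton x g : lev S (automaton x g) = lev S (x g).
Proof. exact: lev_step. Qed.

Lemma automaton_cellular : cellular_automaton automaton.
Proof.
pose M : set G := [set 1; t]%classic.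
have M1 : 1 \in M by rewrite inE; left.
have Mt : t \in M by rewrite inE; right.
exists M; split; first exact: finite_set2.
exists (fun f => step (f (exist _ 1 M1)) (lev S (f (exist _ t Mt)))
                      (bit S (f (exist _ t Mt)))) => x g.
by rewrite /sigL /shift /= invgK mulg1.
Qed.

(** The recursion needs fuel, and [lev S (y g)] is enough of it: each step that
    matters moves to a cell one level lower. *)
Fixpoint undo (n : nat) (y : G -> A) (g : G) : A :=
  if n is m.+1 then
    step (y g) (lev S (y (g * t))) (bit S (undo m y (g * t)))
  else y g.

Definition inverse (y : G -> A) (g : G) : A := undo (lev S (y g)) y g.

Lemma inverseE y g :
  inverse y g = step (y g) (lev S (y (g * t))) (bit S (inverse y (g * t))).
Proof.
rewrite {1}/inverse; case lg: (lev S (y g)) => [|l]; first by rewrite step_lev0.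
rewrite /= /step lg eqSS; case: eqP => //= ->.
by rewrite /inverse.
Qed.

Lemma inverseK : cancel inverse automaton.
Proof.
move=> y; apply: funext => g; rewrite /automaton {1}inverseE.
have -> : lev S (inverse y (g * t)) = lev S (y (g * t)).
  by rewrite inverseE lev_step.
exact: stepK.
Qed.

Lemma automatonK : cancel automaton inverse.
Proof.
move=> x; apply: funext => g.
move: {2}(lev S (x g)) (erefl (lev S (x g))) => l.
elim: l g => [|l IHl] g lg; rewrite inverseE !lev_automaton.
  by rewrite step_lev0 ?lev_automaton // /automaton step_lev0.
have [lgt|/negPf lgt] := eqVneq l (lev S (x (g * t))).
  by rewrite IHl // stepK.
by rewrite /automaton /step lg eqSS lgt /= lg eqSS lgt.
Qed.

Lemma automaton_bij : bijective automaton.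
Proof. by exists inverse; [exact: automatonK | exact: inverseK]. Qed.

(** * No finite memory for the inverse *)

Hypothesis expt_inj : injective (fun n => t ^+ n).

Lemma finite_set_expgN (M : set G) : finite_set M -> exists n, ~ M (t ^+ n).
Proof.
move=> finM; apply: contrapT => /forallNP MtN.
apply: infinite_nat.
have <- : ((fun n => t ^+ n) @^-1` M = setT)%classic.
  by apply/seteqP; split=> // n _; exact: contrapT (MtN n).
by apply: finite_preimage => // m n _ _ /expt_inj.
Qed.

(** The levels decrease along 1, t, ..., t ^+ n, so that each symbol of the chain
    controls the preceding one. The background, of level 0 and bit 0, is never
    flipped and causes no flip. *)
Definition chain (n : nat) (b : bool) (g : G) : A :=
  if [pick i : 'I_n.+1 | g == t ^+ i] is Some i then sym S (n - i) b
  else sym S 0 false.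

Lemma chain_on n b i : (i <= n)%N -> chain n b (t ^+ i) = sym S (n - i) b.
Proof.
rewrite /chain -ltnS => i_n; case: pickP => [j /eqP /expt_inj -> //|].
by move/(_ (Ordinal i_n)); rewrite eqxx.
Qed.

Lemma chain_off n b g :
  (forall i, (i <= n)%N -> g <> t ^+ i) -> chain n b g = sym S 0 false.
Proof.
rewrite /chain => gN; case: pickP => [j /eqP gj|//].
by case: (gN j _ gj); rewrite -ltnS.
Qed.

Lemma automaton_chain n b i : (i < n)%N ->
  automaton (chain n b) (t ^+ i) = sym S (n - i) false.
Proof.
move=> i_n; rewrite /automaton -expgSr !chain_on ?(ltnW i_n) //.
rewrite lev_sym bit_sym /step !lev_sym bit_sym subnSK // eqxx.
by case: b.
Qed.

(** The bits of the chain are erased by its own flips, except at its end, which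
    is of level 0. *)
Lemma automaton_chain_bit n b c g :
  g <> t ^+ n -> automaton (chain n b) g = automaton (chain n c) g.
Proof.
move=> g_n; have [[i i_n ->]|gN] := pselect (exists2 i, (i < n)%N & g = t ^+ i).
  by rewrite !automaton_chain.
have off d : chain n d g = sym S 0 false.
  apply: chain_off => i; rewrite leq_eqVlt => /predU1P[-> //|i_n gi].
  by apply: gN; exists i.
by rewrite /automaton !off !step_lev0 ?lev_sym.
Qed.

Lemma automaton_irreversible : ~ reversible automaton.
Proof.
move=> [sigma [tauK _ [M [finM [mu sigmaE]]]]].
have [n Mtn] := finite_set_expgN finM.
have eq_at_1 : sigma (automaton (chain n false)) 1
             = sigma (automaton (chain n true)) 1.
  rewrite !sigmaE; congr mu; apply: funext => -[m mM].
  have Mm : M m by exact: set_mem mM.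
  rewrite /sigL /shift /= invgK mul1g.
  by apply: automaton_chain_bit => m_n; apply: Mtn; rewrite -m_n.
move: eq_at_1; rewrite !tauK -(expg0 t) !chain_on // => /(congr1 (bit S)).
by rewrite !bit_sym.
Qed.

End Automaton.

(** * Elements of infinite order *)

Lemma nonperiodic_expg_inj (G : groupType) :
  ~ periodic G -> exists t : G, injective (fun n => t ^+ n).
Proof.
move=> /existsNP [t tN]; exists t.
have t_free n : t ^+ n = 1 -> n = 0%N.
  by case: n => // n tn; case: tN; exists n.+1.
have le_inj m n : (m <= n)%N -> t ^+ n = t ^+ m -> n = m.
  move=> mn tmn; apply/eqP; rewrite eqn_leq mn andbT -subn_eq0; apply/eqP.
  by apply: t_free; rewrite expgnFr // tmn mulgV.
by move=> m n /= tmn; case: (leqP m n) => [/le_inj-> //|/ltnW /le_inj ->].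
Qed.

Theorem corollary1p3 (G : groupType) (A : Type)
    (hG : ~ periodic G) (hA : infinite_set [set: A]%classic) :
  exists tau : (G -> A) -> (G -> A),
    [/\ cellular_automaton tau, bijective tau & ~ reversible tau].
Proof.
have [t t_inj] := nonperiodic_expg_inj hG.
have [S _] := infinite_leveled hA.
exists (automaton S t); split.
- exact: automaton_cellular.
- exact: automaton_bij.
- exact: automaton_irreversible.
Qed.
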